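(* Let $\mathscr{A}$ be a $C^*$-algebra, let $\mathscr{X},\mathscr{Y}$ be inner product (pre-Hilbert) $\mathscr{A}$-modules, let $T\colon\mathscr{X}\to\mathscr{Y}$ be a nonvanishing mapping, and let $\gamma\in(0,+\infty)$. Then the following are equivalent: (i) $\langle Tx,Ty\rangle=\gamma^2\langle x,y\rangle$ for all $x,y\in\mathscr{X}$; (ii) $T$ is $\mathscr{A}$-linear and $|Tx|=\gamma|x|$ for all $x\in\mathscr{X}$; (iii) $T$ is ($\mathbb{C}$-)linear and $|Tx|=\gamma|x|$ for all $x\in\mathscr{X}$.
   Context: An inner product $\mathscr{A}$-module is a right $\mathscr{A}$-module $\mathscr{X}$ (complex vector space with compatible right $\mathscr{A}$-action) with an $\mathscr{A}$-valued map $\langle\cdot,\cdot\rangle$ that is linear in the second variable, satisfies $\langle x,ya\rangle=\langle x,y\rangle a$, $\langle x,y\rangle=\langle y,x\rangle^*$, and $\langle x,x\rangle\ge0$ with equality iff $x=0$; completeness is not assumed. For $z$ in such a module, $|z|$ denotes the positive square root of $\langle z,z\rangle$. $T$ is $\mathscr{A}$-linear if it is linear and $T(xa)=(Tx)a$ for all $x$ and $a\in\mathscr{A}$. Nonvanishing means $T$ is not identically zero. *)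

(* Defs.v *)
(* MathComp + MathComp-Analysis; scalars are the complex
   numbers R[i] over an arbitrary realType R. *)
From HB Require Import structures.
From mathcomp Require Import all_boot all_order all_algebra.
From mathcomp Require Import complex.
From mathcomp Require Import all_classical all_reals all_analysis.
Set Implicit Arguments. Unset Strict Implicit. Unset Printing Implicit Defensive.
Import Order.TTheory GRing.Theory Num.Theory.
Local Open Scope ring_scope.
Local Open Scope complex_scope.
Local Open Scope classical_set_scope.

Section CStar.
Variable R : realType.

(* A (not necessarily unital) C*-algebra: a complex Banach space A
   (completeNormedModType over R[i]) with an associative bilinear product
   [mul], a conjugate-linear anti-multiplicative involution [star],
   a submultiplicative norm, and the C*-identity. *)
Definition cstar_algebra (A : completeNormedModType R[i])
    (mul : A -> A -> A) (star : A -> A) : Prop :=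
  (forall a b c : A, mul (mul a b) c = mul a (mul b c))
   /\ (forall a b c : A, mul (a + b) c = mul a c + mul b c)
   /\ (forall a b c : A, mul a (b + c) = mul a b + mul a c)
   /\ (forall (l : R[i]) (a b : A),
          mul (l *: a) b = l *: mul a b /\ mul a (l *: b) = l *: mul a b)
   /\ (forall a b : A, star (a + b) = star a + star b)
   /\ (forall (l : R[i]) (a : A), star (l *: a) = (l^*)%C *: star a)
   /\ (forall a b : A, star (mul a b) = mul (star b) (star a))
   /\ (forall a : A, star (star a) = a)
   /\ (forall a b : A, `|mul a b| <= `|a| * `|b|) /\
      (forall a : A, `|mul (star a) a| = `|a| ^+ 2).

(* Positive elements of a C*-algebra: a >= 0 iff a = b^* b for some b. *)
Definition cpos (A : completeNormedModType R[i])
    (mul : A -> A -> A) (star : A -> A) (a : A) : Prop :=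
  exists b : A, a = mul (star b) b.

(* Inner product A-module (not necessarily complete): a complex vector space X
   with a compatible right A-action [act] and an A-valued inner product [ip]. *)
Definition inner_product_module (A : completeNormedModType R[i])
    (mul : A -> A -> A) (star : A -> A)
    (X : lmodType R[i]) (act : X -> A -> X) (ip : X -> X -> A) : Prop :=
  (forall (x y : X) (a : A), act (x + y) a = act x a + act y a)
   /\ (forall (x : X) (a b : A), act x (a + b) = act x a + act x b)
   /\ (forall (x : X) (a b : A), act (act x a) b = act x (mul a b))
   /\ (forall (l : R[i]) (x : X) (a : A),
          act (l *: x) a = l *: act x a /\ act x (l *: a) = l *: act x a)
   /\ (forall (l : R[i]) (x y z : X), ip x (l *: y + z) = l *: ip x y + ip x z)
   /\ (forall (x y : X) (a : A), ip x (act y a) = mul (ip x y) a)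
   /\ (forall x y : X, ip x y = star (ip y x))
   /\ (forall x : X, cpos mul star (ip x x)) /\
      (forall x : X, ip x x = 0 -> x = 0).

(* |z| : the positive square root of <z,z>. *)
Definition cabs (A : completeNormedModType R[i])
    (mul : A -> A -> A) (star : A -> A)
    (X : lmodType R[i]) (ip : X -> X -> A) (z : X) : A :=
  xget 0 [set b : A | cpos mul star b /\ mul b b = ip z z].

(* C-linearity and A-linearity of a map T : X -> Y. *)
Definition clinear (X Y : lmodType R[i]) (T : X -> Y) : Prop :=
  forall (l : R[i]) (x y : X), T (l *: x + y) = l *: T x + T y.

Definition alinear (A : completeNormedModType R[i])
    (X Y : lmodType R[i]) (actX : X -> A -> X) (actY : Y -> A -> Y)
    (T : X -> Y) : Prop :=
  clinear T /\ forall (x : X) (a : A), T (actX x a) = actY (T x) a.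

End CStar.

(* Main.v *)
(* Once positive square roots exist and are unique in [A], the theorem is
   polarization: squaring [|Tx| = gamma |x|] gives
   [<Tx,Tx> = gamma^2 <x,x>], hence (i), and conversely (i) makes
   [T (l x + y) - l T x - T y] and [T (x a) - (T x) a] orthogonal to themselves.

   The substance is that every [b^* b] has a unique positive square root.  In a
   unital C*-algebra call a self-adjoint [a] positive when [|t - a| <= t] for
   some [t >= 0].  Such elements obviously form a cone and have square roots
   [sqrt t (1 - v)], where [v] is the limit of [v |-> (u + v^2)/2] for
   [u = 1 - a/t].  Squares of self-adjoint elements are positive because
   [k + i sqrt (1 - k^2)] is unitary.  For [a = b^* b], [y = sqrt (a^2)] and
   [n = y - a], the element [c = b n] satisfies [- c^* c = n y n >= 0]; this
   forces [c = 0], then [n^3 = 0], so [a = y] is positive. *)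
Require Import Defs.
From HB Require Import structures.
From mathcomp Require Import all_boot all_order all_algebra.
From mathcomp Require Import complex.
From mathcomp Require Import all_classical all_reals all_analysis.
From mathcomp Require Import ring lra.
Import Order.TTheory GRing.Theory Num.Theory.
Set Implicit Arguments. Unset Strict Implicit. Unset Printing Implicit Defensive.
Local Open Scope ring_scope.
Local Open Scope complex_scope.

(** * Deciding identities in abelian groups by reflection *)

Inductive zexpr := ZAtom of nat | ZZero | ZAdd of zexpr & zexpr | ZOpp of zexpr.

Fixpoint zeval (V : zmodType) (env : seq V) (e : zexpr) : V :=
  match e with
  | ZAtom i => nth 0 env i
  | ZZero => 0
  | ZAdd a b => zeval env a + zeval env b
  | ZOpp a => - zeval env a
  end.

Fixpoint zcoef (e : zexpr) (i : nat) : int :=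
  match e with
  | ZAtom j => (i == j)%:R
  | ZZero => 0
  | ZAdd a b => zcoef a i + zcoef b i
  | ZOpp a => - zcoef a i
  end.

Lemma zevalE (V : zmodType) (env : seq V) e :
  zeval env e = \sum_(i < size env) env`_i *~ zcoef e i.
Proof.
elim: e => [j| |a IHa b IHb|a IH] /=.
- have [lt|ge] := ltnP j (size env); last first.
    rewrite nth_default // big1 // => i _; rewrite eqn_leq.
    by rewrite [(j <= i)%N]leqNgt (leq_trans (ltn_ord i) ge) andbF.
  rewrite (bigD1 (Ordinal lt)) //= eqxx mulr1z big1 ?addr0 // => i.
  by rewrite -val_eqE /= => /negbTE ->.
- by rewrite big1 // => i _; rewrite mulr0z.
- by rewrite IHa IHb -big_split; apply: eq_bigr => i _; rewrite mulrzDr.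
- by rewrite IH -sumrN; apply: eq_bigr => i _; rewrite mulrNz.
Qed.

(** Soundness of [zmod]: by [zevalE] only the integer coefficients of the atoms matter, and
    comparing them is a computation that [isT] closes. *)
Lemma zeval_eq (V : zmodType) (env : seq V) a b :
  all (fun i => zcoef a i == zcoef b i) (iota 0 (size env)) ->
  zeval env a = zeval env b.
Proof.
move=> /allP h; rewrite !zevalE; apply: eq_bigr => i _.
by rewrite (eqP (h i _)) // mem_iota ltn_ord.
Qed.

(* Atoms are compared up to unification: equal products may carry different
   paths to the same ring structure. *)
Ltac zmod_index x env :=
  match env with
  | ?y :: _ => let _ := match goal with _ => unify x y end in constr:(0%N)
  | _ :: ?env' => let i := zmod_index x env' in constr:(i.+1)
  end.

Ltac zmod_mem x env :=
  match env with
  | nil => constr:(false)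
  | ?y :: _ => let _ := match goal with _ => unify x y end in constr:(true)
  | _ :: ?env' => zmod_mem x env'
  end.

Ltac zmod_atoms e env :=
  lazymatch e with
  | (?a + ?b)%R => let env' := zmod_atoms a env in zmod_atoms b env'
  | (- ?a)%R => zmod_atoms a env
  | 0%R => env
  | _ => lazymatch zmod_mem e env with
         | true => env
         | false => constr:(e :: env)
         end
  end.

Ltac zmod_reify e env :=
  lazymatch e with
  | (?a + ?b)%R =>
      let a' := zmod_reify a env in let b' := zmod_reify b env in
      constr:(ZAdd a' b')
  | (- ?a)%R => let a' := zmod_reify a env in constr:(ZOpp a')
  | 0%R => constr:(ZZero)
  | _ => let i := zmod_index e env in constr:(ZAtom i)
  end.

Ltac zmod :=
  lazymatch goal with
  | |- @eq ?T ?a ?b =>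
      let env := zmod_atoms a (@nil T) in
      let env := zmod_atoms b env in
      let a' := zmod_reify a env in
      let b' := zmod_reify b env in
      exact: (@zeval_eq _ env a' b' isT)
  end.

(** * Positivity in unital C*-algebras *)

Section UnitalCStar.
Variables (R : realType) (B : algType R[i]) (st : B -> B) (N : B -> R).

(** The norm is a bare real-valued function, so that it can be put on the unitization without a
    normed-space instance. The C*-identity is one inequality, the form in which it is proved there;
    equality is recovered in [norm_starM]. *)
Record unital_cstar : Prop := UnitalCStar {
  starD : {morph st : x y / x + y};
  starZ : forall l x, st (l *: x) = conjc l *: st x;
  starM : forall x y, st (x * y) = st y * st x;
  starK : involutive st;
  normD : forall x y, N (x + y) <= N x + N y;
  normZ : forall l x, N (l *: x) = complex.Re `|l| * N x;
  normM : forall x y, N (x * y) <= N x * N y;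
  norm_cstar : forall x, N x ^+ 2 <= N (st x * x);
  norm_eq0 : forall x, N x = 0 -> x = 0;
  norm_complete : forall f : nat -> B,
    (forall e, 0 < e -> exists n0, forall m n,
       (n0 <= m)%N -> (n0 <= n)%N -> N (f m - f n) <= e) ->
    exists l, forall e, 0 < e -> exists n0, forall n,
      (n0 <= n)%N -> N (f n - l) <= e }.

Hypothesis BC : unital_cstar.

Let starD := starD BC.
Let starZ := starZ BC.
Let starM := starM BC.
Let starK := starK BC.
Let normD := normD BC.
Let normZ := normZ BC.
Let normM := normM BC.
Let norm_cstar := norm_cstar BC.
Let norm_eq0 := norm_eq0 BC.

Lemma starZr (a : R) x : st (a%:C *: x) = a%:C *: st x.
Proof. by rewrite starZ conjc_real. Qed.

Lemma star0 : st 0 = 0.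
Proof. by apply: (addrI (st 0)); rewrite -starD !addr0. Qed.

Lemma starN x : st (- x) = - st x.
Proof. by apply: (addrI (st x)); rewrite -starD !subrr star0. Qed.

Lemma starB x y : st (x - y) = st x - st y.
Proof. by rewrite starD starN. Qed.

Lemma star1 : st 1 = 1.
Proof. by rewrite -[RHS]starK -[st 1]mul1r starM !starK mul1r. Qed.

Lemma normZr (a : R) x : N (a%:C *: x) = `|a| * N x.
Proof. by rewrite normZ normc_def /= expr0n addr0 sqrtr_sqr. Qed.

Lemma norm0 : N 0 = 0.
Proof. by rewrite -(scale0r 0) (normZr 0) normr0 mul0r. Qed.

Lemma normN x : N (- x) = N x.
Proof. by rewrite -scaleN1r normZ normrN1 mul1r. Qed.

Lemma normiZ x : N ('i%C *: x) = N x.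
Proof. by rewrite normZ normc_def /= expr0n add0r expr1n sqrtr1 mul1r. Qed.

Lemma norm_ge0 x : 0 <= N x.
Proof. by have := normD x (- x); rewrite subrr norm0 normN; lra. Qed.

Lemma normB x y : N (x - y) <= N x + N y.
Proof. by rewrite -(normN y) normD. Qed.

Lemma norm_distC x y : N (x - y) = N (y - x).
Proof. by rewrite -normN opprB. Qed.

(** Divide [N y ^+ 2 <= N (st y * y) <= N (st y) * N y] by [N y], then use this for both [x] and
    [st x]. *)
Lemma norm_star x : N (st x) = N x.
Proof.
suff le y : N y <= N (st y).
  by apply/eqP; rewrite eq_le le andbT -{2}[x]starK le.
have [->|ny] := eqVneq (N y) 0; first exact: norm_ge0.
have yp : 0 < N y by rewrite lt_neqAle eq_sym ny norm_ge0.
rewrite -(ler_pM2r yp) -expr2.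
exact: le_trans (norm_cstar _) (normM _ _).
Qed.

Lemma norm_starM x : N (st x * x) = N x ^+ 2.
Proof.
apply/eqP; rewrite eq_le norm_cstar andbT.
by rewrite expr2 -{1}(norm_star x) normM.
Qed.

Lemma norm1_le : N 1 <= 1.
Proof.
have := norm_starM 1; rewrite star1 mulr1 => h.
have := norm_ge0 1; nra.
Qed.

Lemma half_double (z : B) : (2^-1)%:C *: z + (2^-1)%:C *: z = z.
Proof.
have h : (2^-1 : R) + 2^-1 = 1 by field.
by rewrite -scalerDl -raddfD h scale1r.
Qed.

(** * Square roots of [1 - u] by iteration *)

Fixpoint sqrt_iter (u : B) n : B :=
  if n is m.+1 then (2^-1)%:C *: (u + sqrt_iter u m * sqrt_iter u m) else 0.

Fixpoint sqrt_iter1 n : R :=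
  if n is m.+1 then 2^-1 * (1 + sqrt_iter1 m * sqrt_iter1 m) else 0.

Lemma sqrt_iter1_bounds n : 0 <= sqrt_iter1 n <= 1.
Proof.
elim: n => [|n /andP[h0 h1]] /=; first by rewrite lexx ler01.
by apply/andP; split; nra.
Qed.

(** Take for [n0] an index whose term is within [e] of the supremum. The estimate is one-sided;
    monotonicity comes later, from [norm_sqrt_iterBn]. *)
Lemma sqrt_iter1_cauchy e : 0 < e ->
  exists n0, forall n, (n0 <= n)%N -> sqrt_iter1 n - sqrt_iter1 n0 <= e.
Proof.
move=> e0; pose S := range sqrt_iter1.
have hS : has_sup S.
  split; first by exists (sqrt_iter1 0), 0%N.
  by exists 1 => _ [n _ <-]; case/andP: (sqrt_iter1_bounds n).
have [_ [n0 _ <-] h] := sup_adherent e0 hS.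
exists n0 => n _.
have : sqrt_iter1 n <= sup S by apply: ub_le_sup; [case: hS|exists n].
lra.
Qed.

Lemma commB_sqr (x y : B) : x * y = y * x ->
  x * x - y * y = (x - y) * (x + y).
Proof.
by move=> xy; rewrite mulrBl !mulrDr xy opprD addrA addrK.
Qed.

Lemma comm_sqrt_iter u z n : z * u = u * z ->
  z * sqrt_iter u n = sqrt_iter u n * z.
Proof.
move=> zu; elim: n => [|n IH] /=; first by rewrite mulr0 mul0r.
by rewrite -scalerAr -scalerAl mulrDr mulrDl zu mulrA IH -mulrA IH mulrA.
Qed.

Lemma sqrt_iter_comm u m n :
  sqrt_iter u m * sqrt_iter u n = sqrt_iter u n * sqrt_iter u m.
Proof. by apply: comm_sqrt_iter; rewrite comm_sqrt_iter. Qed.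

Lemma star_sqrt_iter u n : st u = u -> st (sqrt_iter u n) = sqrt_iter u n.
Proof.
move=> su; elim: n => [|n IH] /=; first exact: star0.
by rewrite starZr starD su starM IH.
Qed.

Lemma norm_sqrt_iter u n : N u <= 1 -> N (sqrt_iter u n) <= sqrt_iter1 n.
Proof.
move=> u1; elim: n => [|n IH] /=; first by rewrite norm0.
rewrite normZr ger0_norm ?invr_ge0 // ler_pM2l ?invr_gt0 //.
apply: le_trans (normD _ _) _; apply: lerD => //.
by apply: le_trans (normM _ _) _; apply: ler_pM; rewrite ?norm_ge0.
Qed.

(** Consecutive iterates commute, so each increment is half of [(v - w) * (v + w)]; the scalar
    increments factor in the same way and dominate factor by factor. *)
Lemma norm_sqrt_iterB u n : N u <= 1 ->
  N (sqrt_iter u n.+1 - sqrt_iter u n) <= sqrt_iter1 n.+1 - sqrt_iter1 n.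
Proof.
move=> u1; elim: n => [|n IH].
  by rewrite !subr0; exact: norm_sqrt_iter.
set v := sqrt_iter u n.+1 in IH *; set w := sqrt_iter u n in IH *.
have -> : sqrt_iter u n.+2 - v = (2^-1)%:C *: ((v - w) * (v + w)).
  rewrite -commB_sqr; last exact: sqrt_iter_comm.
  by rewrite {2}/v /= -scalerBr opprD addrACA subrr add0r.
rewrite normZr ger0_norm ?invr_ge0 //.
have hv : N v <= _ := norm_sqrt_iter n.+1 u1.
have hw : N w <= _ := norm_sqrt_iter n u1.
set t := sqrt_iter1 n.+1 in IH hv *; set s := sqrt_iter1 n in IH hw *.
have -> : sqrt_iter1 n.+2 - t = 2^-1 * ((t - s) * (t + s)).
  change (2^-1 * (1 + t * t) - 2^-1 * (1 + s * s) = 2^-1 * ((t - s) * (t + s))).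
  by field.
rewrite ler_pM2l ?invr_gt0 //; apply: le_trans (normM _ _) _.
apply: ler_pM; rewrite ?norm_ge0 //.
by apply: le_trans (normD _ _) _; apply: lerD.
Qed.

Lemma norm_sqrt_iterBn u m n : N u <= 1 -> (m <= n)%N ->
  N (sqrt_iter u n - sqrt_iter u m) <= sqrt_iter1 n - sqrt_iter1 m.
Proof.
move=> u1 /subnK <-; elim: (n - m)%N => [|k IH].
  by rewrite !subrr norm0.
rewrite addSn -(subrKA (sqrt_iter u (k + m))).
apply: le_trans (normD _ _) _.
by have := norm_sqrt_iterB (k + m) u1; lra.
Qed.

(** Passes an identity [F = 0] from approximants to their limit, with a Lipschitz bound needed only
    around [l]. *)
Lemma lipschitz_limit0 (F : B -> B) K (f : nat -> B) l :
  0 <= K -> (forall x, N (F l - F x) <= K * N (x - l)) ->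
  (forall e, 0 < e -> exists n, N (f n - l) <= e /\ N (F (f n)) <= e) ->
  F l = 0.
Proof.
move=> K0 FK fl; apply: norm_eq0; apply/eqP.
rewrite eq_le norm_ge0 andbT; apply/ler_addgt0Pl => e e0; rewrite addr0.
have K1 : 0 < K + 1 by lra.
(* With [e / (K + 1)] the two errors, [K] times it and once it, add up to [e], also when [K = 0]. *)
have [|n [h1 h2]] := fl (e / (K + 1)); first exact: divr_gt0.
rewrite -(subrK (F (f n)) (F l)); apply: le_trans (normD _ _) _.
have -> : e = K * (e / (K + 1)) + e / (K + 1).
  by field; rewrite gt_eqF.
apply: lerD h2; apply: le_trans (FK _) _.
exact: ler_wpM2l.
Qed.

(* The limit of the iteration [v |-> (u + v^2)/2], dominated by its scalar
   version at [u = 1], solves [2v = u + v^2], i.e. [(1 - v)^2 = 1 - u]. *)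
Lemma sqrt_one_sub u : st u = u -> N u <= 1 ->
  exists v, [/\ st v = v, N v <= 1, v + v = u + v * v &
    forall z, z * u = u * z -> z * v = v * z].
Proof.
move=> su u1.
have cau e : 0 < e -> exists n0, forall m n, (n0 <= m)%N -> (n0 <= n)%N ->
    N (sqrt_iter u m - sqrt_iter u n) <= e.
  move=> e0; have [n0 h] := sqrt_iter1_cauchy e0; exists n0.
  have key m n : (n0 <= m)%N -> (m <= n)%N ->
      N (sqrt_iter u n - sqrt_iter u m) <= e.
    move=> le1 le2; apply: le_trans (norm_sqrt_iterBn u1 le2) _.
    have := h n (leq_trans le1 le2).
    have := h m le1.
    (* The scalar iterates increase because their differences bound norms. *)
    have : sqrt_iter1 n0 <= sqrt_iter1 m.
      rewrite -subr_ge0; apply: le_trans (norm_ge0 _) _.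
      exact: norm_sqrt_iterBn u1 le1.
    lra.
  move=> m n hm hn; have [le|/ltnW le] := leqP m n; last exact: key.
  by rewrite norm_distC; exact: key.
have [v hv] := norm_complete BC cau.
have lim0 (F : B -> B) K : 0 <= K ->
    (forall x, N (F v - F x) <= K * N (x - v)) ->
    (forall n, F (sqrt_iter u n) = 0) -> F v = 0.
  move=> K0 FK F0; apply: (@lipschitz_limit0 F K (sqrt_iter u)) => // e e0.
  have [n0 h] := hv e e0; exists n0.
  by rewrite F0 norm0; split; [exact: h|exact: ltW].
have v1 : N v <= 1.
  apply/ler_addgt0Pl => e /hv[n /(_ n (leqnn n))]; rewrite norm_distC => h.
  rewrite -(subrK (sqrt_iter u n) v); apply: le_trans (normD _ _) _.
  apply: lerD h _; apply: le_trans (norm_sqrt_iter n u1) _.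
  by case/andP: (sqrt_iter1_bounds n).
exists v; split => //.
- apply/eqP; rewrite -subr_eq0; apply/eqP.
  apply: (lim0 (fun x => st x - x) 2) => [//|x|n]; last first.
    by rewrite star_sqrt_iter ?subrr.
  have -> : st v - v - (st x - x) = st (v - x) - (v - x).
    rewrite starB. zmod.
  apply: le_trans (normB _ _) _; rewrite norm_star norm_distC; lra.
- apply/eqP; rewrite -subr_eq0; apply/eqP.
  (* This [F] is quadratic, with no global Lipschitz bound, so [lim0] does not apply. Instead [F v]
     is expanded around two consecutive iterates into four terms, each of norm at most [e / 6]. *)
  pose F x := x + x - (u + x * x).
  suff : F v = 0 by [].
  pose w := sqrt_iter u.
  apply: norm_eq0; apply/eqP; rewrite eq_le norm_ge0 andbT.
  apply/ler_addgt0Pl => e e0; rewrite addr0.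
  have [|n1 h1] := hv (e / 6); first exact: divr_gt0.
  have h0 : N (v - w n1) <= e / 6 by rewrite norm_distC; exact: h1.
  have h2 : N (v - w n1.+1) <= e / 6 by rewrite norm_distC; exact: h1.
  have wE : w n1.+1 + w n1.+1 = u + w n1 * w n1.
    by rewrite /w /= half_double.
  have -> : F v = (v - w n1.+1) + (v - w n1.+1)
      - (v * (v - w n1) + (v - w n1) * w n1).
    by rewrite /F !mulrBr !mulrBl -[u](addrK (w n1 * w n1)) -wE; zmod.
  have w1 : N (w n1) <= 1.
    apply: le_trans (norm_sqrt_iter n1 u1) _.
    by case/andP: (sqrt_iter1_bounds n1).
  have M1 : N (v * (v - w n1)) <= e / 6.
    apply: le_trans (normM _ _) _; have := norm_ge0 (v - w n1); nra.
  have M2 : N ((v - w n1) * w n1) <= e / 6.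
    apply: le_trans (normM _ _) _; have := norm_ge0 (v - w n1); nra.
  apply: le_trans (normB _ _) _.
  have := normD (v - w n1.+1) (v - w n1.+1).
  have := normD (v * (v - w n1)) ((v - w n1) * w n1).
  lra.
- move=> z zu; apply/eqP; rewrite -subr_eq0; apply/eqP.
  apply: (lim0 (fun x => z * x - x * z) (N z *+ 2)) => [|x|n].
  + by rewrite mulrn_wge0 ?norm_ge0.
  + have -> : z * v - v * z - (z * x - x * z) = z * (v - x) - (v - x) * z.
      by rewrite mulrBr mulrBl; zmod.
    apply: le_trans (normB _ _) _; rewrite mulr2n (norm_distC x) [leRHS]mulrDl.
    by apply: lerD; [|rewrite mulrC]; exact: normM.
  + by rewrite (comm_sqrt_iter n zu) subrr.
Qed.

(** * Self-adjoint elements and the cone of positive elements *)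

Lemma normMn x n : N (x *+ n) = N x *+ n.
Proof.
rewrite -scaler_nat -(rmorph_nat (real_complex R)) normZr.
by rewrite ger0_norm ?ler0n // mulr_natl.
Qed.

Lemma norm_sqr_sa x : st x = x -> N (x * x) = N x ^+ 2.
Proof. by move=> sx; rewrite -norm_starM sx. Qed.

(** Two uses of the C*-identity give [N x ^+ 4] as the norm of the fourth power, which vanishes with
    the cube. *)
Lemma sa_cube_eq0 x : st x = x -> x * x * x = 0 -> x = 0.
Proof.
move=> sx x3; apply: norm_eq0; apply/eqP.
have : N (x * x * (x * x)) == 0 by rewrite mulrA x3 mul0r norm0.
rewrite norm_sqr_sa; last by rewrite starM sx.
by rewrite norm_sqr_sa // !expf_eq0.
Qed.

(* The Kelley-Vaught form of positivity, which needs no spectrum. *)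
Definition positive a := st a = a /\ exists2 t : R, 0 <= t & N (t%:C%:A - a) <= t.

Lemma star_rA (t : R) : st t%:C%:A = t%:C%:A.
Proof. by rewrite starZr star1. Qed.

Lemma positive0 : positive 0.
Proof. by split; [exact: star0|exists 0; rewrite ?scale0r ?subr0 ?norm0]. Qed.

Lemma positiveD a b : positive a -> positive b -> positive (a + b).
Proof.
move=> [sa [t t0 ta]] [sb [s s0 sb']]; split; first by rewrite starD sa sb.
exists (t + s); first exact: addr_ge0.
have hts : (t + s)%:C = t%:C + s%:C by exact: rmorphD.
have -> : (t + s)%:C%:A - (a + b) = (t%:C%:A - a) + (s%:C%:A - b).
  by rewrite hts scalerDl; zmod.
by apply: le_trans (normD _ _) _; apply: lerD.
Qed.

Lemma positiveZ (l : R) a : 0 <= l -> positive a -> positive (l%:C *: a).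
Proof.
move=> l0 [sa [t t0 ta]]; split; first by rewrite starZr sa.
exists (l * t); first exact: mulr_ge0.
rewrite rmorphM /= -scalerA -scalerBr normZr ger0_norm //.
exact: ler_wpM2l.
Qed.

(** The commutation clause is kept because uniqueness and the positivity of [st b * b] both need
    roots that commute with given elements. *)
Lemma positive_sqrt a : positive a ->
  exists y, [/\ positive y, y * y = a & forall z, z * a = a * z -> z * y = y * z].
Proof.
move=> [sa [t t0 ta]]; have [t00|tn] := eqVneq t 0.
  exists 0; split; [exact: positive0| |by move=> z _; rewrite mulr0 mul0r].
  rewrite mul0r; apply/esym/norm_eq0; apply/eqP; rewrite eq_le norm_ge0 andbT.
  by move: ta; rewrite t00 scale0r sub0r normN.
have tp : 0 < t by rewrite lt_neqAle eq_sym tn.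
have [||v [sv v1 vE vC]] := @sqrt_one_sub (1 - (t^-1)%:C *: a).
- by rewrite starB star1 starZr sa.
- have -> : 1 - (t^-1)%:C *: a = (t^-1)%:C *: (t%:C%:A - a).
    by rewrite scalerBr scalerA -rmorphM /= mulVf // scale1r.
  by rewrite normZr ger0_norm ?invr_ge0 // ler_pdivrMl // mulr1.
exists ((Num.sqrt t)%:C *: (1 - v)); split.
- split; first by rewrite starZr starB star1 sv.
  (* This scalar witnesses positivity because [1 - (1 - v) = v] has norm at most 1. *)
  exists (Num.sqrt t); first exact: sqrtr_ge0.
  rewrite -scalerBr normZr ger0_norm ?sqrtr_ge0 //.
  have -> : 1 - (1 - v) = v by zmod.
  by rewrite ler_piMr ?sqrtr_ge0.
- rewrite -scalerAl -scalerAr scalerA -rmorphM /= -expr2 sqr_sqrtr //.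
  have -> : (1 - v) * (1 - v) = (t^-1)%:C *: a.
    have -> : (t^-1)%:C *: a = 1 + v * v - (v + v) by rewrite vE; zmod.
    by rewrite mulrBr mulr1 mulrBl mul1r; zmod.
  by rewrite scalerA -rmorphM /= mulfV // scale1r.
- move=> z za; rewrite -scalerAl -scalerAr mulrBr mulrBl mulr1 mul1r vC //.
  by rewrite mulrBr mulrBl mulr1 mul1r -scalerAl -scalerAr za.
Qed.

(* With [w = sqrt (1 - k^2)] the element [k + i w] is unitary, which bounds [w]. *)
Lemma norm_one_sub_sqr k : st k = k -> N k <= 1 -> N (1 - k * k) <= 1.
Proof.
move=> sk k1.
have [||v [sv v1 vE vC]] := @sqrt_one_sub (k * k).
- by rewrite starM sk.
- by rewrite norm_sqr_sa // expr_le1 ?norm_ge0.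
have kv : k * v = v * k by apply: vC; rewrite mulrA.
pose w := 1 - v.
have sw : st w = w by rewrite starB star1 sv.
have ww : w * w = 1 - k * k.
  have -> : k * k = v + v - v * v by rewrite vE; zmod.
  by rewrite /w mulrBr mulr1 mulrBl mul1r; zmod.
have kw : k * w = w * k by rewrite /w mulrBr mulrBl mulr1 mul1r kv.
pose U := k + 'i%C *: w.
have sU : st U = k - 'i%C *: w.
  rewrite starD starZ sk sw -scaleNr; congr (_ + _ *: _).
  by apply/eqP; rewrite eq_complex /= oppr0 !eqxx.
have UU : st U * U = 1.
  rewrite sU mulrDr !mulrBl -!scalerAl -!scalerAr scalerA -(expr2 ('i%C : R[i])) sqr_i kw.
  by rewrite scaleN1r ww; zmod.
have U1 : N U <= 1.
  by have := norm_starM U; rewrite UU; have := norm1_le; have := norm_ge0 U; nra.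
(* [U - st U] is [2 i w], and both [U] and [st U] have norm at most 1. *)
have w1 : N w <= 1.
  have : N (U - st U) <= 1 + 1.
    by apply: le_trans (normB _ _) _; rewrite norm_star lerD.
  have -> : U - st U = 'i%C *: (w *+ 2) by rewrite sU /U -scalerMnr mulr2n; zmod.
  by rewrite normiZ normMn mulr2n; lra.
by rewrite -ww norm_sqr_sa // expr_le1 ?norm_ge0.
Qed.

Lemma norm_sub_sqr h : st h = h -> N ((N h ^+ 2)%:C%:A - h * h) <= N h ^+ 2.
Proof.
move=> sh; have [h0|hn] := eqVneq (N h) 0.
  by rewrite (norm_eq0 h0) mul0r norm0 expr0n scale0r subrr norm0.
pose k := ((N h)^-1)%:C *: h.
have k1 : N k <= 1 by rewrite normZr ger0_norm ?invr_ge0 ?norm_ge0 // mulVf.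
have -> : (N h ^+ 2)%:C%:A - h * h = (N h ^+ 2)%:C *: (1 - k * k).
  rewrite scalerBr -scalerAl -scalerAr !scalerA -!rmorphM /=.
  by rewrite (_ : _ * _ * _ = 1) ?scale1r //; field.
rewrite normZr ger0_norm ?sqr_ge0 // ler_piMr ?sqr_ge0 //.
by apply: norm_one_sub_sqr => //; rewrite starZr sh.
Qed.

Lemma positive_sqr h : st h = h -> positive (h * h).
Proof.
move=> sh; split; first by rewrite starM sh.
by exists (N h ^+ 2); [exact: sqr_ge0|exact: norm_sub_sqr].
Qed.

(** The scalar hidden in [positive] can be taken to be the norm, since [a] is the square of a
    self-adjoint element. *)
Lemma positive_norm_sub a : positive a -> N ((N a)%:C%:A - a) <= N a.
Proof.
move=> /positive_sqrt[y [[sy _] <- _]].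
by rewrite norm_sqr_sa // norm_sub_sqr.
Qed.

(** With [s = N a], both [s + a] and [s - a] have norm at most [s]. The difference of their squares
    is [4 s a], so [4 s^2 <= 2 s^2]. *)
Lemma positive_proper a : positive a -> positive (- a) -> a = 0.
Proof.
move=> /positive_norm_sub h1 /positive_norm_sub.
rewrite normN opprK => h2; apply: norm_eq0.
set s := N a in h1 h2 *; have s0 : 0 <= s by exact: norm_ge0.
set X := s%:C%:A in h1 h2.
have E : (X + a) * (X + a) - (X - a) * (X - a) = (s%:C *: a) *+ 4.
  have aX : a * X = s%:C *: a by rewrite mulr_algr.
  have Xa : X * a = s%:C *: a by rewrite mulr_algl.
  rewrite !mulrDr !mulrDl !mulrN !mulNr aX Xa !mulrS mulr0n; zmod.
have := normB ((X + a) * (X + a)) ((X - a) * (X - a)).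
rewrite E normMn normZr ger0_norm // -/s.
have := normM (X + a) (X + a); have := normM (X - a) (X - a).
have := norm_ge0 (X + a); have := norm_ge0 (X - a).
rewrite -mulr_natl => *; nra.
Qed.

(* With [p = - c^* c], [q = c c^*] and [t = |p| = |q|], contractivity of [t - q]
   and [c (t + p) = (t - q) c] bound [(t + p) p (t + p)] by [t^3]; then
   [4 t p^2 = (t + p) p (t + p) - (t - p) p (t - p)] forces [4 t^3 <= 2 t^3]. *)
Lemma positive_oppM_eq0 c : positive (- (st c * c)) -> c = 0.
Proof.
set p := - (st c * c) => pp; pose q := c * st c.
have pq : positive q.
  pose h := c + st c; pose k := 'i%C *: (c - st c).
  have sh : st h = h by rewrite starD starK addrC.
  have sk : st k = k.
    rewrite /k starZ starB starK -[c - st c]opprB scalerN -scaleNr.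
    by congr (_ *: _); apply/eqP; rewrite eq_complex /= oppr0 !eqxx.
  have -> : q = (2^-1)%:C *: (h * h + k * k + p + p).
    have E : h * h + k * k + p + p = q + q.
      rewrite -scalerAl -scalerAr scalerA -(expr2 ('i%C : R[i])) sqr_i scaleN1r.
      by rewrite /h /p /q !mulrDr !mulrDl !mulrN !mulNr; zmod.
    by rewrite E scalerDr half_double.
  apply: positiveZ; first by rewrite invr_ge0.
  by do 2![apply: positiveD => //]; apply: positiveD; exact: positive_sqr.
have pN : N p = N c ^+ 2 by rewrite normN norm_starM.
have qN : N q = N c ^+ 2 by rewrite -[X in N (X * _)]starK norm_starM norm_star.
have hp := positive_norm_sub pp; have hq := positive_norm_sub pq.
set t := N c ^+ 2 in pN qN; rewrite pN in hp; rewrite qN in hq.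
have t0 : 0 <= t by exact: sqr_ge0.
set X := t%:C%:A in hp hq.
have Xl z : X * z = t%:C *: z by rewrite mulr_algl.
have Xr z : z * X = t%:C *: z by rewrite mulr_algr.
have cE : c * (X + p) = (X - q) * c.
  by rewrite mulrDr mulrBl Xl Xr mulrN mulrA.
have sXp : st (X + p) = X + p by rewrite starD star_rA pp.1.
have h1 : N ((X + p) * p * (X + p)) <= t ^+ 3.
  have -> : (X + p) * p * (X + p) = - (st (c * (X + p)) * (c * (X + p))).
    by rewrite starM sXp mulrN mulNr !mulrA.
  rewrite normN norm_starM cE.
  have -> : t ^+ 3 = (t * N c) ^+ 2 by rewrite exprMn -/t exprSr.
  rewrite ler_sqr ?nnegrE ?norm_ge0 ?mulr_ge0 ?norm_ge0 //.
  by apply: le_trans (normM _ _) _; rewrite ler_wpM2r ?norm_ge0.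
have h2 : N ((X - p) * p * (X - p)) <= t ^+ 3.
  have n0 := norm_ge0 (X - p); have m1 := normM (X - p) p.
  rewrite pN in m1.
  apply: le_trans (normM _ _) _.
  have m2 := norm_ge0 ((X - p) * p).
  have m3 : N ((X - p) * p) <= t * t by apply: le_trans m1 _; rewrite ler_wpM2r.
  by rewrite exprSr expr2; apply: ler_pM.
have E r : (X + r) * r * (X + r) - (X - r) * r * (X - r) = (t%:C *: (r * r)) *+ 4.
  rewrite !(mulrDr, mulrDl, mulrN, mulNr).
  rewrite !Xr !Xl -!scalerAl !mulrS mulr0n; zmod.
have := normB ((X + p) * p * (X + p)) ((X - p) * p * (X - p)).
rewrite E normMn normZr ger0_norm // norm_sqr_sa ?pp.1 // pN -exprS => h3.
apply: norm_eq0; apply/eqP.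
have h4 : t ^+ 3 <= 0 by move: h3; rewrite -mulr_natl; lra.
have : t ^+ 3 == 0 by rewrite eq_le h4 exprn_ge0.
by rewrite /t !expf_eq0.
Qed.

Lemma positive_star_mul b : positive (st b * b).
Proof.
set a := st b * b; have sa : st a = a by rewrite starM starK.
have [y [py yy yC]] := positive_sqrt (positive_sqr sa).
have [s [[ss _] sy sC]] := positive_sqrt py.
have ay : a * y = y * a by apply: yC; rewrite mulrA.
have as_ : a * s = s * a by exact: sC.
have ys : y * s = s * y by rewrite -sy mulrA.
pose n := y - a; have sn : st n = n by rewrite starB py.1 sa.
have ns : n * s = s * n by rewrite mulrBl mulrBr ys as_.
have an : a * n = - (y * n) by rewrite !mulrBr ay -yy; zmod.
have E : - (st (b * n) * (b * n)) = n * (y * n).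
  by rewrite starM sn mulrA -(mulrA n) -/a -mulrA an mulrN opprK.
(* Since [s] commutes with [n], [n y n] is the square of the self-adjoint element [s n]. *)
have bn : b * n = 0.
  apply: positive_oppM_eq0; rewrite E -sy -mulrA mulrA ns.
  by apply: positive_sqr; rewrite starM sn ss ns.
have nyn : n * (y * n) = 0 by rewrite -E bn mulr0 oppr0.
have n0 : n = 0.
  apply: sa_cube_eq0 => //.
  (* From [a n = - y n] the square [(y - a) n] is [2 y n], hence [n^3 = 2 n y n = 0]. *)
  have nn : n * n = y * n + y * n by rewrite -[X in _ + X]opprK -an; exact: mulrBl.
  by rewrite -mulrA nn mulrDr nyn addr0.
by have -> : a = y by rewrite -(subrK a y) -/n n0 add0r.
Qed.

(** For [d = a - b], commutation gives [d (a + b) d = (a^2 - b^2) d = 0]. So the positive elements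
    [d a d] and [d b d] are opposite, hence zero, and their difference is [d^3]. *)
Lemma comm_positive_inj a b : positive a -> positive b -> a * b = b * a ->
  a * a = b * b -> a = b.
Proof.
move=> pa pb ab aabb; pose d := a - b.
have sd : st d = d by rewrite starB pa.1 pb.1.
have dpd x : positive x -> positive (d * x * d).
  move=> /positive_sqrt[s [[ss _] <- _]].
  have -> : d * (s * s) * d = st (s * d) * (s * d) by rewrite starM sd ss !mulrA.
  exact: positive_star_mul.
have E : d * a * d + d * b * d = 0.
  by rewrite -mulrDl -mulrDr mulrBl !mulrDr ab aabb; rewrite (_ : _ - _ = 0) ?mul0r //; zmod.
have dad : d * a * d = 0.
  apply: positive_proper; first exact: dpd.
  by rewrite -[- _]addr0 -E addKr; exact: dpd.
have dbd : d * b * d = 0 by rewrite -E dad add0r.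
apply/eqP; rewrite -subr_eq0; apply/eqP/(sa_cube_eq0 sd).
have -> : d * d * d = d * a * d - d * b * d by rewrite -mulrBl -mulrBr.
by rewrite dad dbd subrr.
Qed.

(** Here [a] and [b] are not known to commute, but the constructed root [y] of their common square
    commutes with each; both are compared with [y]. *)
Lemma positive_sqr_inj a b : positive a -> positive b -> a * a = b * b -> a = b.
Proof.
move=> pa pb aabb; have [y [py yy yC]] := positive_sqrt (positive_sqr pa.1).
have -> : a = y by apply: comm_positive_inj => //; rewrite yC // mulrA.
apply/esym/comm_positive_inj => //; last by rewrite yy.
by rewrite yC // aabb mulrA.
Qed.

End UnitalCStar.

(** * Unitization *)

Section RealNorm.
Variable R : realType.

(** The ambient norm takes values in [R[i]]; its real part carries the same information in [R],
    where infima are available. *)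
Definition rnorm (V : normedZmodType R[i]) (a : V) : R := complex.Re `|a|.

Lemma rnormE (V : normedZmodType R[i]) (a : V) : `|a| = (rnorm a)%:C.
Proof. by rewrite /rnorm RRe_real ?normr_real. Qed.

Lemma rnorm_ge0 (V : normedZmodType R[i]) (a : V) : 0 <= rnorm a.
Proof. by rewrite -ler0c -rnormE. Qed.

Lemma rnormD (V : normedZmodType R[i]) (a b : V) : rnorm (a + b) <= rnorm a + rnorm b.
Proof. by rewrite -lecR rmorphD /= -!rnormE ler_normD. Qed.

Lemma rnormN (V : normedZmodType R[i]) (a : V) : rnorm (- a) = rnorm a.
Proof. by rewrite /rnorm normrN. Qed.

Lemma rnorm_eq0 (V : normedZmodType R[i]) (a : V) : rnorm a = 0 -> a = 0.
Proof. by move=> a0; apply/eqP; rewrite -normr_eq0 rnormE a0. Qed.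

Lemma rnorm0 (V : normedZmodType R[i]) : rnorm (0 : V) = 0.
Proof. by rewrite /rnorm normr0. Qed.

Lemma rnormZ (V : normedModType R[i]) (l : R[i]) (a : V) : rnorm (l *: a) = rnorm l * rnorm a.
Proof. by apply: complexI; rewrite rmorphM /= -!rnormE normrZ. Qed.

Lemma rnormM (k l : R[i]) : rnorm (k * l) = rnorm k * rnorm l.
Proof. by apply: complexI; rewrite rmorphM /= -!rnormE normrM. Qed.

Lemma rnorm_conj (l : R[i]) : rnorm (conjc l) = rnorm l.
Proof. by rewrite /rnorm normcJ. Qed.

Lemma Re_le_rnorm (l : R[i]) : `|complex.Re l| <= rnorm l.
Proof. by rewrite -lecR -rnormE normc_ge_Re. Qed.

Lemma Im_le_rnorm (l : R[i]) : `|complex.Im l| <= rnorm l.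
Proof.
have := Re_le_rnorm (l * 'i%C); rewrite ReiNIm normrN rnormM.
by rewrite [rnorm 'i%C]/rnorm normc_def /= expr0n add0r expr1n sqrtr1 mulr1.
Qed.

Definition rcauchy (V : normedZmodType R[i]) (f : nat -> V) :=
  forall e, 0 < e -> exists n0, forall m n,
    (n0 <= m)%N -> (n0 <= n)%N -> rnorm (f m - f n) <= e.

Definition rlimit (V : normedZmodType R[i]) (f : nat -> V) l :=
  forall e, 0 < e -> exists n0, forall n, (n0 <= n)%N -> rnorm (f n - l) <= e.

End RealNorm.

Lemma cauchy_norm_lim (K : numFieldType) (V : completeNormedModType K)
    (f : nat -> V) :
  (forall e, 0 < e -> exists n0, forall m n,
     (n0 <= m)%N -> (n0 <= n)%N -> `|f m - f n| <= e) ->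
  exists l, forall e, 0 < e -> exists n0, forall n,
    (n0 <= n)%N -> `|f n - l| <= e.
Proof.
move=> cf.
have : cvg (f @ \oo)%classic.
  apply: cauchy_cvg; apply/cauchy_ballP => e e0; rewrite near_map2.
  (* Halving turns the non-strict bound into the strict one that balls require. *)
  have [|n0 h] := cf (e / 2); first exact: divr_gt0.
  exists ([set n | (n0 <= n)%N], [set n | (n0 <= n)%N])%classic.
    by split; exists n0.
  move=> [m n] [/= hm hn]; rewrite -ball_normE /=.
  apply: le_lt_trans (h _ _ hm hn) _.
  by rewrite ltr_pdivrMr // ltr_pMr // ltr1n.
move=> /cvg_ex[l fl]; exists l => e e0.
move/cvgr_dist_le : fl => /(_ e e0) [n0 _ h]; exists n0 => n /h /=.
by rewrite distrC.
Qed.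

Lemma rcauchy_lim (R : realType) (A : completeNormedModType R[i]) (f : nat -> A) :
  rcauchy f -> exists l, rlimit f l.
Proof.
move=> cf; have [e e0|l hl] := cauchy_norm_lim (f := f).
  have eE : e = (complex.Re e)%:C by rewrite RRe_real // ger0_real // ltW.
  have [|n0 h] := cf (complex.Re e); first by rewrite -ltcR -eE.
  by exists n0 => m n hm hn; rewrite eE rnormE lecR h.
exists l => e e0; have [|n0 h] := hl e%:C; first by rewrite ltcR.
by exists n0 => n /h; rewrite rnormE lecR.
Qed.

Lemma rcauchy_lim_complex (R : realType) (f : nat -> R[i]) :
  rcauchy f -> exists l, rlimit f l.
Proof.
move=> cf.
have [|a ha] := @cauchy_norm_lim R R^o (fun n => complex.Re (f n)).
  move=> e /cf[n0 h]; exists n0 => m n hm hn; rewrite -raddfB.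
  exact: le_trans (Re_le_rnorm _) (h _ _ hm hn).
have [|b hb] := @cauchy_norm_lim R R^o (fun n => complex.Im (f n)).
  move=> e /cf[n0 h]; exists n0 => m n hm hn; rewrite -raddfB.
  exact: le_trans (Im_le_rnorm _) (h _ _ hm hn).
exists (a +i* b) => e e0; have e2 : 0 < e / 2 by exact: divr_gt0.
have [na Ha] := ha _ e2; have [nb Hb] := hb _ e2.
exists (maxn na nb) => n; rewrite geq_max => /andP[/Ha h1 /Hb h2].
rewrite [f n]complexE [a +i* b]complexE /=.
have -> : (complex.Re (f n))%:C + 'i%C * (complex.Im (f n))%:C - (a%:C + 'i%C * b%:C) =
  (complex.Re (f n) - a)%:C + 'i%C * (complex.Im (f n) - b)%:C :> R[i].
  by rewrite !rmorphB /=; ring.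
apply: le_trans (rnormD _ _) _; rewrite rnormM.
have rr (x : R) : rnorm (x%:C : R[i]) = `|x|.
  by rewrite /rnorm normc_def /= expr0n addr0 sqrtr_sqr.
have -> : rnorm ('i%C : R[i]) = 1.
  by rewrite /rnorm normc_def /= expr0n add0r expr1n sqrtr1.
by rewrite !rr; lra.
Qed.

Section Unitization.
Variables (R : realType) (A : completeNormedModType R[i]).
Variables (mul : A -> A -> A) (star : A -> A).

(** The argument [HA] makes the type remember [mul] and [star], so that the algebra instances can be
    attached to it. *)
Definition unitization (HA : cstar_algebra mul star) : Type := (R[i]^o * A)%type.

Variable HA : cstar_algebra mul star.
Local Notation U := (unitization HA).
Implicit Types (a b c : A) (u v w : U).

Let cmulA a b c : mul (mul a b) c = mul a (mul b c).
Proof. by case: HA. Qed.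
Let cmulDl a b c : mul (a + b) c = mul a c + mul b c.
Proof. by case: HA => _ []. Qed.
Let cmulDr a b c : mul a (b + c) = mul a b + mul a c.
Proof. by case: HA => _ [_ []]. Qed.
Let cmulZl l a b : mul (l *: a) b = l *: mul a b.
Proof. by case: HA => _ [_ [_ [/(_ l a b)[]]]]. Qed.
Let cmulZr l a b : mul a (l *: b) = l *: mul a b.
Proof. by case: HA => _ [_ [_ [/(_ l a b)[]]]]. Qed.
Let cstarD a b : star (a + b) = star a + star b.
Proof. by case: HA => _ [_ [_ [_ []]]]. Qed.
Let cstarZ l a : star (l *: a) = conjc l *: star a.
Proof. by case: HA => _ [_ [_ [_ [_ []]]]]. Qed.
Let cstarM a b : star (mul a b) = mul (star b) (star a).
Proof. by case: HA => _ [_ [_ [_ [_ [_ []]]]]]. Qed.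
Let cstarK a : star (star a) = a.
Proof. by case: HA => _ [_ [_ [_ [_ [_ [_ []]]]]]]. Qed.
Let cnormM a b : rnorm (mul a b) <= rnorm a * rnorm b.
Proof.
case: HA => _ [_ [_ [_ [_ [_ [_ [_ [/(_ a b) h _]]]]]]]].
by rewrite -lecR rmorphM /= -!rnormE.
Qed.
Let cnorm_star a : rnorm (mul (star a) a) = rnorm a ^+ 2.
Proof.
case: HA => _ [_ [_ [_ [_ [_ [_ [_ [_ /(_ a) h]]]]]]]].
apply: complexI; rewrite rmorphXn /= -!rnormE. exact: h.
Qed.

Let cmul0l a : mul 0 a = 0.
Proof. by apply: (addrI (mul 0 a)); rewrite -cmulDl !addr0. Qed.
Let cmul0r a : mul a 0 = 0.
Proof. by apply: (addrI (mul a 0)); rewrite -cmulDr !addr0. Qed.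

HB.instance Definition _ := GRing.Lmodule.copy U (R[i]^o * A)%type.

Definition umul u v : U := (u.1 * v.1, u.1 *: v.2 + v.1 *: u.2 + mul u.2 v.2).
Definition ustar u : U := (conjc u.1, star u.2).

Lemma umulA : associative umul.
Proof.
move=> [r a] [s b] [t c]; rewrite /umul /=; congr (_, _); first exact: mulrA.
rewrite !cmulDl !cmulDr !cmulZl !cmulZr cmulA !scalerDr !scalerA.
by rewrite [t * r]mulrC [t * s]mulrC; zmod.
Qed.

Lemma umul1 : left_id ((1, 0) : U) umul.
Proof.
by move=> [s b]; rewrite /umul /= mul1r scale1r scaler0 cmul0l !addr0.
Qed.

Lemma umulr1 : right_id ((1, 0) : U) umul.
Proof.
by move=> [s b]; rewrite /umul /= mulr1 scale1r scaler0 cmul0r add0r addr0.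
Qed.

Lemma umulDl : left_distributive umul +%R.
Proof.
move=> [r a] [s b] [t c]; rewrite /umul /=; congr (_, _); first exact: mulrDl.
by rewrite /= cmulDl scalerDl scalerDr; zmod.
Qed.

Lemma umulDr : right_distributive umul +%R.
Proof.
move=> [r a] [s b] [t c]; rewrite /umul /=; congr (_, _); first exact: mulrDr.
by rewrite /= cmulDr scalerDl scalerDr; zmod.
Qed.

Lemma uone_neq0 : ((1, 0) : U) != 0.
Proof. by apply/eqP => -[] /eqP; rewrite oner_eq0. Qed.

HB.instance Definition _ := GRing.Zmodule_isNzRing.Build U
  umulA umul1 umulr1 umulDl umulDr uone_neq0.

Lemma uscalerAl (l : R[i]) u v : l *: (u * v) = (l *: u) * v.
Proof.
apply: injective_projections => /=; first exact: mulrA.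
by rewrite cmulZl !scalerDr !scalerA [l * v.1]mulrC.
Qed.

HB.instance Definition _ := GRing.Lmodule_isLalgebra.Build R[i] U uscalerAl.

Lemma uscalerAr (l : R[i]) u v : l *: (u * v) = u * (l *: v).
Proof.
apply: injective_projections => /=; first exact: mulrCA.
by rewrite cmulZr !scalerDr !scalerA [l * u.1]mulrC.
Qed.

HB.instance Definition _ := GRing.Lalgebra_isAlgebra.Build R[i] U uscalerAr.

(** The product of [u] with an element of the ideal [A], hence a left action of the unitization on
    [A]. *)
Definition uact u a : A := u.1 *: a + mul u.2 a.

Lemma uactD u v a : uact (u + v) a = uact u a + uact v a.
Proof. by rewrite /uact /= scalerDl cmulDl; zmod. Qed.

Lemma uactZ l u a : uact (l *: u) a = l *: uact u a.
Proof. by rewrite /uact /= cmulZl scalerDr scalerA. Qed.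

Lemma uactM u v a : uact (u * v) a = uact u (uact v a).
Proof.
rewrite /uact /= !cmulDl !cmulZl !cmulDr cmulZr !scalerDr scalerA cmulA; zmod.
Qed.

(* [k] bounds [u] both modulo [A] and as a left multiplier of [A]; when [A] has
   a unit, the multiplier alone would not detect [1 - e]. *)
Definition ubound u k :=
  [/\ 0 <= k, rnorm u.1 <= k & forall a, rnorm (uact u a) <= k * rnorm a].

(** The maximum of the modulus of the scalar part and the operator norm of [uact u]. *)
Definition unorm u : R := inf [set k | ubound u k]%classic.

Lemma ubound_nonempty u : ubound u (rnorm u.1 + rnorm u.2).
Proof.
split=> [||a]; first by rewrite addr_ge0 ?rnorm_ge0.
  by rewrite lerDl rnorm_ge0.
apply: le_trans (rnormD _ _) _; rewrite mulrDl rnormZ.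
by rewrite lerD.
Qed.

Lemma unorm_le u k : ubound u k -> unorm u <= k.
Proof.
by move=> uk; apply: ge_inf => //; exists 0 => ? [].
Qed.

(** The infimum is attained: every condition in [ubound] is a lower bound on [k], after division by
    [rnorm a] when that is nonzero. *)
Lemma uboundP u : ubound u (unorm u).
Proof.
have ne : ([set k | ubound u k] !=set0)%classic.
  by exists (rnorm u.1 + rnorm u.2); exact: ubound_nonempty.
have lb (x : R) : (forall k, ubound u k -> x <= k) -> x <= unorm u.
  by move=> h; apply: lb_le_inf.
split=> [||a]; first by apply: lb => k [].
  by apply: lb => k [].
have [a0|an] := eqVneq (rnorm a) 0.
  by rewrite (rnorm_eq0 a0) /uact scaler0 cmul0r addr0 !rnorm0 mulr0.
have ap : 0 < rnorm a by rewrite lt_neqAle eq_sym an rnorm_ge0.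
by rewrite -ler_pdivrMr //; apply: lb => k [_ _ h]; rewrite ler_pdivrMr.
Qed.

Lemma unorm_ge0 u : 0 <= unorm u. Proof. by case: (uboundP u). Qed.

Lemma unormD u v : unorm (u + v) <= unorm u + unorm v.
Proof.
have [u0 u1 u2] := uboundP u; have [v0 v1 v2] := uboundP v.
apply: unorm_le; split=> [||a]; first exact: addr_ge0.
  by apply: le_trans (rnormD _ _) _; exact: lerD.
by rewrite uactD mulrDl; apply: le_trans (rnormD _ _) _; exact: lerD.
Qed.

Lemma unormZ l u : unorm (l *: u) = rnorm l * unorm u.
Proof.
have le k v : unorm (k *: v) <= rnorm k * unorm v.
  have [v0 v1 v2] := uboundP v.
  apply: unorm_le; split=> [||a]; first by rewrite mulr_ge0 ?rnorm_ge0.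
    by rewrite rnormM ler_wpM2l ?rnorm_ge0.
  by rewrite uactZ rnormZ -mulrA ler_wpM2l ?rnorm_ge0.
apply/eqP; rewrite eq_le le /=.
have [->|l0] := eqVneq l 0; first by rewrite rnorm0 mul0r unorm_ge0.
have lp : 0 < rnorm l.
  by rewrite lt_neqAle rnorm_ge0 andbT eq_sym; apply: contra_neq l0 => /rnorm_eq0.
have {1}-> : u = l^-1 *: (l *: u) by rewrite scalerA mulVf // scale1r.
have lV : rnorm l * rnorm l^-1 = 1.
  by rewrite -rnormM mulfV // /rnorm normr1.
by rewrite -[leRHS]mul1r -lV -mulrA ler_wpM2l ?rnorm_ge0 // le.
Qed.

Lemma unormM u v : unorm (u * v) <= unorm u * unorm v.
Proof.
have [u0 u1 u2] := uboundP u; have [v0 v1 v2] := uboundP v.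
apply: unorm_le; split=> [||a]; first exact: mulr_ge0.
  by rewrite rnormM ler_pM ?rnorm_ge0.
rewrite uactM; apply: le_trans (u2 _) _.
by rewrite -mulrA ler_wpM2l.
Qed.

Let cnorm_starr a : rnorm (star a) = rnorm a.
Proof.
suff le b : rnorm b <= rnorm (star b).
  by apply/eqP; rewrite eq_le le andbT -{2}[a]cstarK le.
have [->|nb] := eqVneq (rnorm b) 0; first exact: rnorm_ge0.
have bp : 0 < rnorm b by rewrite lt_neqAle eq_sym nb rnorm_ge0.
by rewrite -(ler_pM2r bp) -expr2 -cnorm_star cnormM.
Qed.

(** The square root of [unorm (ustar u * u)] is a bound for [u]: on [A], [|u a|^2 = |(u a)^* (u a)|
    = |a^* (u^* u a)|], which is at most [|a|^2] times that norm. *)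
Lemma unorm_cstar u : unorm u ^+ 2 <= unorm (ustar u * u).
Proof.
have [k0 k1 k2] := uboundP (ustar u * u); set k := unorm _ in k0 k1 k2 *.
rewrite -[leRHS]sqr_sqrtr // ler_sqr ?nnegrE ?unorm_ge0 ?sqrtr_ge0 //.
apply: unorm_le; split=> [||a]; first exact: sqrtr_ge0.
  rewrite -ler_sqr ?nnegrE ?rnorm_ge0 ?sqrtr_ge0 // sqr_sqrtr //.
  by apply: le_trans k1; rewrite rnormM rnorm_conj.
rewrite -ler_sqr ?nnegrE ?mulr_ge0 ?rnorm_ge0 ?sqrtr_ge0 // exprMn sqr_sqrtr //.
rewrite -cnorm_star.
have adj b : mul (star (uact u a)) b = mul (star a) (uact (ustar u) b).
  by rewrite /uact cstarD cstarZ cstarM cmulDl cmulZl cmulA cmulDr cmulZr.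
rewrite adj -uactM.
apply: le_trans (cnormM _ _) _; rewrite cnorm_starr.
by rewrite expr2 mulrCA ler_wpM2l ?rnorm_ge0.
Qed.

Lemma unorm_eq0 u : unorm u = 0 -> u = 0.
Proof.
move=> u0; have [_ h1 h2] := uboundP u; rewrite u0 in h1 h2.
have u1 : u.1 = 0 by apply: rnorm_eq0; apply/eqP; rewrite eq_le h1 rnorm_ge0.
apply: injective_projections => //=.
have := h2 (star u.2); rewrite mul0r /uact u1 scale0r add0r -{1}[u.2]cstarK.
rewrite cnorm_star cnorm_starr => h; apply: rnorm_eq0; apply/eqP.
by rewrite -sqrf_eq0 eq_le h sqr_ge0.
Qed.

(** For [a = u.2], the identity [a a^* = u a^* - u.1 a^*] gives [|a|^2 <= 2 |u| |a|]. Thus Cauchy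
    sequences of the unitization have Cauchy components. *)
Lemma rnorm2_le u : rnorm u.2 <= unorm u *+ 2.
Proof.
have [u0 u1 u2] := uboundP u.
have [->|an] := eqVneq (rnorm u.2) 0; first by rewrite mulrn_wge0.
have ap : 0 < rnorm u.2 by rewrite lt_neqAle eq_sym an rnorm_ge0.
rewrite -(ler_pM2r ap).
have E : mul u.2 (star u.2) = uact u (star u.2) - u.1 *: star u.2.
  by rewrite /uact; zmod.
have := cnorm_star (star u.2); rewrite cstarK cnorm_starr expr2 E => h.
rewrite -h; apply: le_trans (rnormD _ _) _.
rewrite rnormN rnormZ cnorm_starr mulr2n mulrDl lerD //; last first.
  by rewrite ler_wpM2r ?rnorm_ge0.
by apply: le_trans (u2 _) _; rewrite cnorm_starr.
Qed.

Lemma unorm_complete (f : nat -> U) :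
  (forall e, 0 < e -> exists n0, forall m n,
     (n0 <= m)%N -> (n0 <= n)%N -> unorm (f m - f n) <= e) ->
  exists l, forall e, 0 < e -> exists n0, forall n,
    (n0 <= n)%N -> unorm (f n - l) <= e.
Proof.
move=> cf.
have [|s hs] := @rcauchy_lim_complex R (fun n => (f n).1).
  move=> e /cf[n0 h]; exists n0 => m n hm hn.
  by apply: le_trans (h _ _ hm hn); case: (uboundP (f m - f n)).
have [|a ha] := @rcauchy_lim R A (fun n => (f n).2).
  move=> e e0; have [|n0 h] := cf (e / 2); first exact: divr_gt0.
  exists n0 => m n hm hn; apply: le_trans (rnorm2_le (f m - f n)) _.
  by rewrite mulr2n [leRHS]splitr; apply: lerD; exact: h.
exists (s, a) => e e0; have e2 : 0 < e / 2 by exact: divr_gt0.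
have [n1 h1] := hs _ e2; have [n2 h2] := ha _ e2.
exists (maxn n1 n2) => n; rewrite geq_max => /andP[/h1 hn1 /h2 hn2].
apply: le_trans (unorm_le (ubound_nonempty _)) _.
by rewrite [leRHS]splitr; apply: lerD; [exact: hn1|exact: hn2].
Qed.

Lemma unitization_cstar : unital_cstar ustar unorm.
Proof.
split.
- by move=> u v; apply: injective_projections; rewrite /= ?rmorphD ?cstarD.
- by move=> l u; apply: injective_projections; rewrite /= ?rmorphM ?cstarZ.
- move=> u v; apply: injective_projections => /=.
    by rewrite rmorphM mulrC.
  rewrite !cstarD !cstarZ cstarM; zmod.
- by move=> u; apply: injective_projections; rewrite /= ?conjcK ?cstarK.
- exact: unormD.
- exact: unormZ.
- exact: unormM.
- exact: unorm_cstar.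
- exact: unorm_eq0.
- exact: unorm_complete.
Qed.

(** * Bringing square roots back from the unitization to [A] *)

Let inA a : U := (0, a).

Let inAM a b : inA a * inA b = inA (mul a b).
Proof.
by apply: injective_projections; rewrite /= ?mulr0 // !scale0r !add0r.
Qed.

(** The scalar part of [u] has square zero, so roots of elements of [A] stay in [A]. *)
Let inA_sqr u a : u * u = inA a -> u = inA u.2.
Proof.
move=> uu; apply: injective_projections => //=.
by apply/eqP; rewrite -sqrf_eq0 expr2; apply/eqP; case: uu.
Qed.

Let cpos_positive a : cpos mul star a -> positive ustar unorm (inA a).
Proof.
move=> [b ->]; rewrite -inAM.
have -> : inA (star b) = ustar (inA b) 
    by apply: injective_projections => //; exact/esym/conjc0.
exact: positive_star_mul unitization_cstar _.
Qed.

Lemma cpos_sqrt a : cpos mul star a ->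
  exists b, cpos mul star b /\ mul b b = a.
Proof.
move=> /cpos_positive /(positive_sqrt unitization_cstar)[y [py yy _]].
have yE := inA_sqr yy; exists y.2; split; last first.
  by move: yy; rewrite yE inAM => -[].
(* A root [s] of the root [y] is self-adjoint and again in [A], so it presents [y] as [s^* s], as
   [cpos] demands. *)
have [s [[ss _] sy _]] := positive_sqrt unitization_cstar py.
have sE : s = inA s.2 by apply: (@inA_sqr _ y.2); rewrite sy.
exists s.2; move: sy; rewrite sE yE inAM => -[<-].
by congr (mul _ _); rewrite -[in LHS]ss.
Qed.

Lemma cpos_sqr_inj a b : cpos mul star a -> cpos mul star b ->
  mul a a = mul b b -> a = b.
Proof.
move=> /cpos_positive pa /cpos_positive pb ab.
have : inA a = inA b by apply: (positive_sqr_inj unitization_cstar pa pb); rewrite !inAM ab.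
by case.
Qed.

End Unitization.

(** * Inner product modules *)

(** Polarization: expand the diagonal at [l *: x + y] and compare [l = 1] with [l = i]. *)
Lemma sesquilinear_diag0 (R : realType) (X A : lmodType R[i]) (G : X -> X -> A) :
  (forall l x y z, G x (l *: y + z) = l *: G x y + G x z) ->
  (forall l x y z, G (l *: x + y) z = conjc l *: G x z + G y z) ->
  (forall x, G x x = 0) -> forall x y, G x y = 0.
Proof.
move=> Gr Gl G0 x y.
have E l : l *: G y x + conjc l *: G x y = 0.
  have := G0 (l *: x + y); rewrite Gr !Gl !G0 scaler0 add0r addr0 => <-.
  by rewrite addrC.
have := E 1; rewrite conjc1 !scale1r => /eqP; rewrite addr_eq0 => /eqP e1.
have := E 'i%C; rewrite e1 scalerN => /eqP.
have -> : conjc 'i%C = - 'i%C :> R[i] by apply/eqP; rewrite eq_complex /= oppr0 !eqxx.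
rewrite scaleNr -opprD oppr_eq0 -scalerDl scaler_eq0 -mulr2n mulrn_eq0 /=.
by case/orP => /eqP // /eqP; rewrite eq_complex /= oner_eq0 andbF.
Qed.

Section InnerProductModule.
Variables (R : realType) (A : completeNormedModType R[i]).
Variables (mul : A -> A -> A) (star : A -> A) (HA : cstar_algebra mul star).
Variables (X : lmodType R[i]) (act : X -> A -> X) (ip : X -> X -> A).
Hypothesis HX : inner_product_module mul star act ip.

Lemma ip_linearr l x y z : ip x (l *: y + z) = l *: ip x y + ip x z.
Proof. by case: HX => _ [_ [_ [_ []]]]. Qed.

Lemma ip_actr x y a : ip x (act y a) = mul (ip x y) a.
Proof. by case: HX => _ [_ [_ [_ [_ []]]]]. Qed.

Lemma ip_star x y : ip x y = star (ip y x).
Proof. by case: HX => _ [_ [_ [_ [_ [_ []]]]]]. Qed.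

Lemma ip_cpos x : cpos mul star (ip x x).
Proof. by case: HX => _ [_ [_ [_ [_ [_ [_ []]]]]]]. Qed.

Lemma ip_eq0 x : ip x x = 0 -> x = 0.
Proof. by case: HX => _ [_ [_ [_ [_ [_ [_ [_ h]]]]]]]; exact: h. Qed.

Lemma ip0r x : ip x 0 = 0.
Proof.
by have := ip_linearr (-1) x 0 0; rewrite scaler0 addr0 scaleN1r addNr.
Qed.

Lemma ipDr x y z : ip x (y + z) = ip x y + ip x z.
Proof. by have := ip_linearr 1 x y z; rewrite !scale1r. Qed.

Lemma ipZr l x y : ip x (l *: y) = l *: ip x y.
Proof. by have := ip_linearr l x y 0; rewrite ip0r !addr0. Qed.

Lemma ipBr x y z : ip x (y - z) = ip x y - ip x z.
Proof. by rewrite ipDr -scaleN1r ipZr scaleN1r. Qed.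

Lemma ip_linearl l x y z : ip (l *: x + y) z = conjc l *: ip x z + ip y z.
Proof.
case: HA => _ [_ [_ [_ [sD [sZ _]]]]].
by rewrite ip_star ip_linearr sD sZ -!ip_star.
Qed.

Lemma ip_sym0 x y : ip x y = 0 -> ip y x = 0.
Proof.
case: HA => _ [_ [_ [_ [sD _]]]].
by move=> xy; rewrite ip_star xy; apply: (addrI (star 0)); rewrite -sD !addr0.
Qed.

(** Since roots exist in [A], the default value 0 in [cabs] is never a fallback. *)
Lemma cabsP x : cpos mul star (cabs mul star ip x) /\
  mul (cabs mul star ip x) (cabs mul star ip x) = ip x x.
Proof.
exact: (xgetPex 0 (P := [set b : A | cpos mul star b /\ mul b b = ip x x])%classic)
  (cpos_sqrt HA (ip_cpos x)).
Qed.

End InnerProductModule.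

Lemma cposZ (R : realType) (A : completeNormedModType R[i])
    (mul : A -> A -> A) (star : A -> A) (HA : cstar_algebra mul star)
    (g : R) (a : A) : 0 <= g -> cpos mul star a -> cpos mul star (g%:C *: a).
Proof.
case: HA => _ [_ [_ [mZ [_ [sZ _]]]]] g0 [b ->].
exists ((Num.sqrt g)%:C *: b).
rewrite sZ conjc_real (mZ _ _ _).1 (mZ _ _ _).2 scalerA -rmorphM /=.
by rewrite -expr2 sqr_sqrtr.
Qed.

(** * The implications between the three conditions *)

Section Similarity.
Variables (R : realType) (A : completeNormedModType R[i]).
Variables (mul : A -> A -> A) (star : A -> A) (HA : cstar_algebra mul star).
Variables (X Y : lmodType R[i]).
Variables (actX : X -> A -> X) (ipX : X -> X -> A).
Hypothesis HX : inner_product_module mul star actX ipX.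
Variables (actY : Y -> A -> Y) (ipY : Y -> Y -> A).
Hypothesis HY : inner_product_module mul star actY ipY.
Variables (T : X -> Y) (gamma : R).

(** The defect [w] is orthogonal to the range of [T], hence to linear combinations and [A]-multiples
    of the range, and so to itself. *)
Lemma similarity_alinear :
  (forall x y, ipY (T x) (T y) = (gamma ^+ 2)%:C *: ipX x y) ->
  alinear actX actY T.
Proof.
case: (HA) => _ [mDl [_ [mZ _]]] h.
have mul0 a : mul 0 a = 0 by apply: (addrI (mul 0 a)); rewrite -mDl !addr0.
split=> [l x y|x a]; apply/eqP; rewrite -subr_eq0; apply/eqP.
  set w := _ - _.
  have w0 z : ipY w (T z) = 0.
    apply: (ip_sym0 HA HY).
    rewrite (ipBr HY) (ip_linearr HY) !h (ip_linearr HX) scalerDr !scalerA.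
    by rewrite [l * _]mulrC subrr.
  by apply: (ip_eq0 HY); rewrite {2}/w (ipBr HY) (ip_linearr HY) !w0 scaler0 !addr0 subrr.
set w := _ - _.
have w0 z : ipY w (T z) = 0.
  apply: (ip_sym0 HA HY).
  by rewrite (ipBr HY) (ip_actr HY) !h (ip_actr HX) (mZ _ _ _).1 subrr.
by apply: (ip_eq0 HY); rewrite {2}/w (ipBr HY) (ip_actr HY) !w0 mul0 subrr.
Qed.

(** Both sides are positive, the right one because [gamma] is nonnegative, and have equal squares;
    uniqueness of roots concludes. *)
Lemma similarity_cabs : 0 <= gamma ->
  (forall x y, ipY (T x) (T y) = (gamma ^+ 2)%:C *: ipX x y) ->
  forall x, cabs mul star ipY (T x) = gamma%:C *: cabs mul star ipX x.
Proof.
case: (HA) => _ [_ [_ [mZ _]]] g0 h x.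
have [px xx] := cabsP HA HX x; have [py yy] := cabsP HA HY (T x).
apply: (cpos_sqr_inj HA py); first exact: cposZ.
by rewrite yy h (mZ _ _ _).1 (mZ _ _ _).2 scalerA -rmorphM xx expr2.
Qed.

(** The difference of the two sides is sesquilinear, since [T] is linear, and squaring the
    hypothesis kills its diagonal. *)
Lemma cabs_similarity : clinear T ->
  (forall x, cabs mul star ipY (T x) = gamma%:C *: cabs mul star ipX x) ->
  forall x y, ipY (T x) (T y) = (gamma ^+ 2)%:C *: ipX x y.
Proof.
case: (HA) => _ [_ [_ [mZ _]]] lT h x y.
apply/eqP; rewrite -subr_eq0; apply/eqP; move: x y.
apply: sesquilinear_diag0 => [l x y z|l x y z|x].
- rewrite lT (ip_linearr HX) (ip_linearr HY) scalerBr scalerDr !scalerA.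
  by rewrite [l * _]mulrC; zmod.
- rewrite lT (ip_linearl HA HX) (ip_linearl HA HY) scalerBr scalerDr !scalerA.
  by rewrite [conjc l * _]mulrC; zmod.
- have [_ <-] := cabsP HA HX x; have [_ <-] := cabsP HA HY (T x).
  by rewrite h (mZ _ _ _).1 (mZ _ _ _).2 scalerA -rmorphM expr2 subrr.
Qed.

End Similarity.

Theorem theorem4p6 (R : realType) (A : completeNormedModType R[i])
    (mul : A -> A -> A) (star : A -> A) (HA : cstar_algebra mul star)
    (X Y : lmodType R[i])
    (actX : X -> A -> X) (ipX : X -> X -> A)
    (HX : inner_product_module mul star actX ipX)
    (actY : Y -> A -> Y) (ipY : Y -> Y -> A)
    (HY : inner_product_module mul star actY ipY)
    (T : X -> Y) (HT : exists x : X, T x != 0)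
    (gamma : R) (Hgamma : 0 < gamma) :
  let P1 := forall x y : X, ipY (T x) (T y) = (gamma ^+ 2)%:C *: ipX x y in
  let P2 := alinear actX actY T /\
            forall x : X, cabs mul star ipY (T x) = gamma%:C *: cabs mul star ipX x in
  let P3 := clinear T /\
            forall x : X, cabs mul star ipY (T x) = gamma%:C *: cabs mul star ipX x in
  (P1 <-> P2) /\ (P2 <-> P3).
Proof.
have P31 := cabs_similarity HA HX HY (T := T) (gamma := gamma).
split; split.
- move=> h; split; first exact: (similarity_alinear HA HX HY h).
  exact: (similarity_cabs HA HX HY (ltW Hgamma) h).
- by case=> -[lT _]; exact: P31.
- by case=> -[].
- case=> lT h; split=> //.
  exact: (similarity_alinear HA HX HY (P31 lT h)).
Qed.
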